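(* Let $n,T\ge1$ and let $z_1,\ldots,z_{n+1}$ be positive reals with $z_1+\cdots+z_{n+1}=1$. Consider the Markov chain on staircase tableaux $\mathcal{T}_n^T$ described in the context. Then $$\Pi(V)=\prod_{k=1}^n\prod_{i=1}^{T-1}\mathcal{C}_V(i,k),\qquad V\in\mathcal{T}_n^T,$$ satisfies $\sum_{V\in\mathcal{T}_n^T}\Pi(V)=(z_1+\cdots+z_{n+1})^{n(T-1)}=1$ and is the stationary distribution of this chain.
   Context: Let $y_m=z_1+\cdots+z_m$, $y_0=0$. The staircase diagram has $n$ columns; column $k$ (from the left) consists of $n+1-k$ cells occupying rows $1,\ldots,n+1-k$, rows being counted from the bottom (so row $r$ has cells in columns $1,\ldots,n+1-r$). $\mathcal{T}_n^T$ is the set of fillings of this diagram in which each cell is empty or contains an integer in $\{1,\ldots,T-1\}$, such that the nonempty entries strictly increase along each row from left to right and along each column from bottom to top. For $V\in\mathcal{T}_n^T$, $i\in\{1,\ldots,T-1\}$, $k\in\{1,\ldots,n\}$: if $i$ appears in column $k$, in row $r$, then $\mathcal{C}_V(i,k)=z_{1+m}$ where $m$ is the number of cells of column $k$ above row $r$ such that no cell of the same row to their right contains an entry $\le i$; otherwise $\mathcal{C}_V(i,k)=1-y_m$ where $m$ is the number of cells $x$ of column $k$ such that no entry $\le i$ appears in $x$, in any cell of the same row to the right of $x$, or in any cell of column $k$ above $x$. Transitions: from $V$ to $W\in\mathcal{T}_n^T$ the probability is $\prod_{i=1}^{T-1}\mathcal{C}_W(i,1)$ if, for all $k\in\{1,\ldots,n-1\}$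 and $r\in\{1,\ldots,n-k\}$, the cell in column $k+1$, row $r$ of $W$ has the same content (entry or empty) as the cell in column $k$, row $r+1$ of $V$; and $0$ otherwise. (That is: the bottom row is deleted, everything moves one step down and one step right, and a new first column is filled.) *)

(* Defs.v *)
From mathcomp Require Import all_boot all_order all_algebra.

Set Implicit Arguments.
Unset Strict Implicit.
Unset Printing Implicit Defensive.

Import Order.TTheory GRing.Theory Num.Theory.

Local Open Scope ring_scope.

(* Columns (from the left), rows (from the bottom) and entries are all        *)
(* numbered from 0 here: the pair (k, r) is the cell in column k + 1 and row  *)
(* r + 1, and j : 'I_T.-1 is the entry j + 1 of {1, ..., T - 1}. Column k + 1 *)
(* has n - k cells, whence the condition k + r < n.                           *)
Definition cell (n : nat) := {c : 'I_n * 'I_n | (c.1 + c.2 < n)%N}.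

Definition ccol (n : nat) (c : cell n) : 'I_n := (val c).1.
Definition crow (n : nat) (c : cell n) : 'I_n := (val c).2.

Definition right_of (n : nat) (x d : cell n) : bool :=
  (crow d == crow x) && (ccol x < ccol d)%N.

Definition above (n : nat) (x d : cell n) : bool :=
  (ccol d == ccol x) && (crow x < crow d)%N.

Definition filling (n T : nat) := {ffun cell n -> option 'I_T.-1}.

Definition is_tableau (n T : nat) (V : filling n T) : bool :=
  [forall c : cell n, forall d : cell n,
    (right_of c d || above c d) ==>
      (if V c is Some a then if V d is Some b then (a < b)%N else true
       else true)].

Definition tableau (n T : nat) := {V : filling n T | is_tableau V}.

Definition entry_le (n T : nat) (V : filling n T) (i : 'I_T.-1) (d : cell n) :
    bool :=
  if V d is Some j then (j <= i)%N else false.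

Section Weights.
Variables (R : realFieldType) (z : nat -> R) (n T : nat).

Definition ysum (m : nat) : R := \sum_(1 <= j < m.+1) z j.

Definition free_above (V : filling n T) (i : 'I_T.-1) (c : cell n) : nat :=
  #|[set x : cell n | above c x &
       ~~ [exists d : cell n, right_of x d && entry_le V i d]]|.

Definition free_in_col (V : filling n T) (i : 'I_T.-1) (k : 'I_n) : nat :=
  #|[set x : cell n | ccol x == k &
       ~~ [exists d : cell n,
             [|| d == x, right_of x d | above x d] && entry_le V i d]]|.

(* In a tableau an entry appears at most once in a column, so the picked cell *)
(* is the only candidate.                                                     *)
Definition Cweight (V : filling n T) (i : 'I_T.-1) (k : 'I_n) : R :=
  if [pick c : cell n | (ccol c == k) && (V c == Some i)] is Some c
  then z (1 + free_above V i c)%N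
  else 1 - ysum (free_in_col V i k).

Definition shift_compatible (V W : filling n T) : bool :=
  [forall c : cell n, forall d : cell n,
    ((ccol d == (ccol c).+1 :> nat) && (crow c == (crow d).+1 :> nat)) ==>
      (W d == V c)].

(* The condition k = 0 selects the first column.                              *)
Definition trans (V W : tableau n T) : R :=
  if shift_compatible (val V) (val W)
  then \prod_(k < n | k == 0%N :> nat) \prod_(i < T.-1) Cweight (val W) i k
  else 0.

Definition PiT (V : tableau n T) : R :=
  \prod_(k < n) \prod_(i < T.-1) Cweight (val V) i k.

End Weights.

Definition stochastic (R : realFieldType) (S : finType) (P : S -> S -> R) :
    Prop :=
  (forall s t, 0 <= P s t) /\ (forall s, \sum_t P s t = 1).

Definition stationary_distribution (R : realFieldType) (S : finType)
    (P : S -> S -> R) (mu : S -> R) : Prop :=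
  [/\ forall s, 0 <= mu s,
      \sum_s mu s = 1
    & forall t, \sum_s mu s * P s t = mu t].

(* Main.v *)
(* In increasing order of i, the value i enters a column either in one of its *)
(* M free cells, with weights z_1, ..., z_M, or not at all, with weight       *)
(* 1 - y_M. Hence the weights of the fillings of one column, given the        *)
(* columns to its right, sum to 1; this yields stochasticity and, column by   *)
(* column, the total mass of Pi.                                              *)
(*   For stationarity, fix everything above the bottom row and again insert   *)
(* the values i one by one. If the free columns carry the factors             *)
(* a_k = 1 - y_(m_k) without the bottom row, then a free bottom cell replaces *)
(* a_k by b_k = 1 - y_(m_k + 1), and placing i in column c contributes        *)
(*   (prod_(k < c) a_k) (a_c - b_c) (prod_(k > c) b_k),                       *)
(* so the sum over all placements telescopes to prod_k a_k.                   *)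
(*   For uniqueness, filling the first column with blanks n times leads from  *)
(* any state to the empty tableau with positive probability.                  *)

Require Import Defs.
From mathcomp Require Import all_boot all_order all_algebra.

Set Implicit Arguments.
Unset Strict Implicit.
Unset Printing Implicit Defensive.

Import Order.TTheory GRing.Theory Num.Theory.

Local Open Scope ring_scope.

(** The row sums of the kernel and the stationarity equation are both sums over the fillings of one
    line of cells with the rest held fixed: the new first column in one case, the deleted bottom row
    in the other. [line_sum] evaluates such a sum value by value. The weight of a value ignores
    larger entries, so if the choices for each value have a total that does not depend on the
    earlier choices, the sum is the product of these totals.

    For a column each total is 1 ([column_sum]). This gives stochasticity and, stripping columns
    from the left, [total_mass]. For the bottom row each total is the product of the column weights
    computed without that row ([row_sum], through [prod_telescope]). The diagonal move turns these
    into the weights of all columns of the target but the first ([Tweight_unshift]), and the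
    transition probability supplies the first.

    For uniqueness, positivity of the weights ([Cweight_gt0]) makes the empty tableau reachable from
    every state, and [stationary_unique] applies. *)

(** * Rank sums, telescoping products, uniqueness of stationary laws *)

(** Counting the elements ranked above is a bijection from [G] onto the numbers below [#|G|]; the
    induction removes the lowest element, whose count is [#|G| - 1]. *)
Lemma sum_rank (R : nmodType) (I : finType) (p : I -> nat) (G : {set I})
    (f : nat -> R) :
  {in G &, injective p} ->
  \sum_(c in G) f #|[set x in G | (p c < p x)%N]| = \sum_(m < #|G|) f m.
Proof.
have [N] := ubnP #|G|; elim: N G => // N IH G ltGN injp.
have [->|/set0Pn[x0 x0G]] := eqVneq G set0; first by rewrite big_set0 cards0 big_ord0.
case: (@arg_minnP _ x0 (mem G) p x0G) => c /= cG cmin.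
have {}cG : c \in G by [].
have cardG : #|G| = #|G :\ c|.+1 by rewrite (cardsD1 c) cG.
rewrite (big_setD1 c) //= cardG big_ord_recr /= addrC; congr (_ + _).
  rewrite -IH; first last.
  - by move=> x y /setD1P[_ xG] /setD1P[_ yG]; apply: injp.
  - by move: ltGN; rewrite cardG.
  apply: eq_bigr => d /setD1P[dc dG]; congr (f _); apply: eq_card => x.
  rewrite !inE; case: eqVneq => //= -> {x}.
  by rewrite cG /= ltnNge cmin.
congr (f _); apply: eq_card => x; rewrite !inE.
case xG: (x \in G); rewrite ?andbF //= andbT.
have [->|xc] := eqVneq x c; first by rewrite ltnn.
rewrite ltn_neqAle cmin // andbT; apply/eqP => /injp e.
by rewrite e ?eqxx // in xc.
Qed.

(** With H_c the product taking [a] before position c and [b] from c on, the summand at c is H_(c+1)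
    - H_c. *)
Lemma prod_telescope (R : comNzRingType) (n : nat) (a b : 'I_n -> R) :
  \prod_k b k +
    \sum_(c < n) \prod_(k < n) (if (k < c)%N then a k else
                    if k == c then a k - b k else b k) = \prod_k a k.
Proof.
elim: n a b => [|n IH] a b; first by rewrite !big_ord0 addr0.
rewrite [X in X + _]big_ord_recl [RHS]big_ord_recl /=.
rewrite -(IH (fun k => a (lift ord0 k)) (fun k => b (lift ord0 k))).
rewrite big_ord_recl big_ord_recl /= addrA.
rewrite (eq_bigr (fun k => b (lift ord0 k))); last by [].
rewrite -mulrDl mulrDr; congr (_ + _); first by rewrite addrC subrK.
rewrite mulr_sumr; apply: eq_bigr => c _.
by rewrite big_ord_recl /=.
Qed.

(** The difference [d] of two stationary laws is fixed by [P], and so are its positive and negative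
    parts. A nonnegative fixed vector that is positive somewhere is positive at [e], since every
    state leads there. Both parts cannot be positive at [e], so [d] has constant sign; its sum is 0,
    hence it vanishes. *)
Lemma stationary_unique (R : realFieldType) (S : finType) (P : S -> S -> R)
    (E : S -> S) (e : S) (N : nat) (mu nu : S -> R) :
  stochastic P -> (forall s, 0 < P s (E s)) -> (forall s, iter N E s = e) ->
  stationary_distribution P mu -> stationary_distribution P nu -> mu =1 nu.
Proof.
move=> [P0 P1] PE Ee [_ mu1 muP] [_ nu1 nuP].
pose d s := mu s - nu s.
have dP t : \sum_s d s * P s t = d t.
  by under eq_bigr do rewrite mulrBl; rewrite sumrB muP nuP.
have absP t : \sum_s `|d s| * P s t = `|d t|.
  have le s : `|d s| <= \sum_x `|d x| * P x s.
    rewrite -[d s]dP; apply: le_trans (ler_norm_sum _ _ _) _.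
    by apply: ler_sum => x _; rewrite normrM (ger0_norm (P0 _ _)).
  (* Both sides of the pointwise inequality have the same total, as the rows of [P] sum to 1, so it
     is an equality everywhere. *)
  have tot : \sum_s (\sum_x `|d x| * P x s - `|d s|) = 0.
    rewrite sumrB exchange_big /=.
    under eq_bigr do rewrite -mulr_sumr P1 mulr1.
    by rewrite subrr.
  move/eqP: tot; rewrite psumr_eq0 => [/allP/(_ t)|s _]; last by rewrite subr_ge0.
  by rewrite mem_index_enum => /(_ isT) /=; rewrite subr_eq0 => /eqP.
have pos_e (f : S -> R) : (forall s, 0 <= f s) ->
    (forall t, \sum_s f s * P s t = f t) -> forall s, 0 < f s -> 0 < f e.
  move=> f0 fP s fs; rewrite -(Ee s).
  suff itP m : 0 < f (iter m E s) by exact: itP.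
  elim: m => //= m fm.
  rewrite -fP (bigD1 (iter m E s)) //=; apply: ltr_wpDr; last exact: mulr_gt0.
  by apply: sumr_ge0 => x _; apply: mulr_ge0.
have pos_d (b : bool) s : 0 < (-1) ^+ b * d s -> 0 < (-1) ^+ b * d e.
  (* [f] is twice the positive part of [d] or of its negative, according to [b]. *)
  move=> ds; pose f x := `|d x| + (-1) ^+ b * d x.
  have fE x : 0 < f x -> 0 < (-1) ^+ b * d x.
    rewrite /f -(normrMsign b) => f0; rewrite real_ltNge ?num_real //.
    by apply/negP => le0; rewrite ler0_norm // addNr ltxx in f0.
  apply: fE; apply: (pos_e f _ _ s).
  - by move=> x; rewrite /f -(normrMsign b) -lerBlDr sub0r -normrN ler_norm.
  - move=> t; under eq_bigr do rewrite mulrDl -mulrA.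
    by rewrite big_split /= absP -mulr_sumr dP.
  - by rewrite /f; apply: ltr_wpDl.
have d0 : \sum_s d s = 0 by rewrite sumrB mu1 nu1 subrr.
have key (b : bool) : (forall s, 0 <= (-1) ^+ b * d s) -> forall s, d s = 0.
  move=> db s.
  have /eqP : \sum_s (-1) ^+ b * d s = 0 by rewrite -mulr_sumr d0 mulr0.
  rewrite psumr_eq0 // => /allP/(_ s); rewrite mem_index_enum => /(_ isT) /=.
  by rewrite mulf_eq0 signr_eq0 /= => /eqP.
suff ds0 s : d s = 0 by move=> s; apply/eqP; rewrite -subr_eq0; apply/eqP/ds0.
have [de|de] := ler0P (d e).
  apply: (key true) => x; rewrite expr1 mulN1r oppr_ge0 leNgt; apply/negP => dx.
  by have := pos_d false x; rewrite expr0 !mul1r => /(_ dx); rewrite ltNge de.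
apply: (key false) => x; rewrite expr0 mul1r leNgt; apply/negP => dx.
have := pos_d true x; rewrite expr1 !mulN1r !oppr_gt0 => /(_ dx).
by rewrite ltNge ltW.
Qed.

(** * Inserting values one by one on a line of cells *)

Section Fillings.
Variables n T : nat.
Implicit Types (V U W : filling n T) (c d x : cell n) (i j a b : 'I_T.-1).

Lemma cell_eq c d : ccol c = ccol d :> nat -> crow c = crow d :> nat -> c = d.
Proof.
move=> ek er; apply: val_inj; case: c d ek er => [[k r] /= kr] [[k' r'] /= kr'].
by rewrite /ccol /crow /= => /val_inj -> /val_inj ->.
Qed.

Lemma tableauP V :
  reflect (forall c d a b, right_of c d || above c d ->
             V c = Some a -> V d = Some b -> (a < b)%N)
          (is_tableau V).
Proof.
apply: (iffP forallP) => [tV c d a b cd Vc Vd | tV c].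
  by move: (tV c) => /forallP/(_ d)/implyP/(_ cd); rewrite Vc Vd.
apply/forallP => d; apply/implyP => cd.
by case Vc: (V c) => [a|//]; case Vd: (V d) => [b|//]; apply: (tV c d).
Qed.

Definition upd V c j : filling n T := [ffun x => if x == c then Some j else V x].

Definition entries_lt (j : nat) (o : option 'I_T.-1) : bool :=
  if o is Some a then (a < j)%N else true.

Definition agree_off (L : pred (cell n)) V U : bool :=
  [forall c, ~~ L c ==> (V c == U c)].

Lemma agree_offP (L : pred (cell n)) V U :
  reflect (forall c, ~~ L c -> V c = U c) (agree_off L V U).
Proof.
apply: (iffP forallP) => [H c /(implyP (H c))/eqP //|H c].
by apply/implyP => /H ->.
Qed.

(** This covers columns and the bottom row at once; strict increase then allows each value at most
    once on [L]. *)
Definition line (L : pred (cell n)) : Prop :=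
  forall c d, L c -> L d ->
    c = d \/ (right_of c d || above c d) \/ (right_of d c || above d c).

(** What the value [m] can see of a cell: larger entries count as blank. *)
Definition cut (m : nat) (o : option 'I_T.-1) : option 'I_T.-1 :=
  if o is Some a then if (a <= m)%N then o else None else None.

Lemma entry_le_cut V i d : entry_le V i d = isSome (cut i (V d)).
Proof. by rewrite /entry_le; case: (V d) => //= a; case: ifP. Qed.

Lemma cut_eq_Some i o : (o == Some i) = (cut i o == Some i).
Proof.
case: o => //= a; case: ifP => // /negbT; rewrite -ltnNge => ia.
by apply/eqP => -[ai]; rewrite ai ltnn in ia.
Qed.

Section LineSum.
Variables (R : comNzRingType) (L : pred (cell n)) (V0 : filling n T).
Variables (w : 'I_T.-1 -> filling n T -> R) (A : 'I_T.-1 -> R).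

(** The possible states after the values below [m] have been treated. *)
Definition partial_ext (m : nat) V : bool :=
  [&& is_tableau V, agree_off L V V0 &
      [forall c, L c ==> entries_lt m (V c)]].

Lemma partial_extP (m : nat) V :
  reflect [/\ is_tableau V, (forall c, ~~ L c -> V c = V0 c) &
              (forall c, L c -> entries_lt m (V c))] (partial_ext m V).
Proof.
apply: (iffP and3P) => [[tV /agree_offP aV /forallP lV]|[tV aV lV]].
  by split=> // c; apply/implyP.
by split=> //; [apply/agree_offP | apply/forallP => c; apply/implyP/lV].
Qed.

Definition can_add U j c : bool :=
  [&& L c, U c == None & is_tableau (upd U c j)].

Hypothesis lineL : line L.
Hypothesis tabV0 : is_tableau V0.
Hypothesis V0L : forall c, L c -> V0 c = None.
Hypothesis w_cut : forall i V V',
  (forall c, cut i (V c) = cut i (V' c)) -> w i V = w i V'.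
(** Skipping [j] or placing it in any admissible cell has total weight [A j], wherever the smaller
    values went; this independence makes the sum factor. *)
Hypothesis w_step : forall j U, partial_ext j U ->
  w j U + \sum_(c | can_add U j c) w j (upd U c j) = A j.

Let erase j V : filling n T := [ffun c => if L c && (V c == Some j) then None else V c].

Let partial_ext_erase j V : partial_ext j.+1 V -> partial_ext j (erase j V).
Proof.
case/partial_extP => /tableauP tV aV lV; apply/partial_extP; split.
- apply/tableauP => c d a b cd; rewrite !ffunE.
  by case: ifP => // _ Vc; case: ifP => // _ Vd; apply: (tV c d).
- by move=> c Lc; rewrite ffunE (negbTE Lc) /= aV.
- move=> c Lc; rewrite ffunE Lc /=; move/lV: Lc.
  case: (V c) => //= a; rewrite ltnS leq_eqVlt => /orP[/eqP aj|aj].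
    by rewrite (_ : a = j) ?eqxx //; apply: val_inj.
  by case: eqP.
Qed.

Let erase_id j U : partial_ext j U -> erase j U = U.
Proof.
case/partial_extP => _ _ lU; apply/ffunP => c; rewrite ffunE.
case: ifP => // /andP[/lU + /eqP Uc].
by rewrite Uc /= ltnn.
Qed.

Let partial_extW (m : nat) V : partial_ext m V -> partial_ext m.+1 V.
Proof.
case/partial_extP => tV aV lV; apply/partial_extP; split=> // c /lV.
by case: (V c) => //= a /ltnW.
Qed.

(** The fibre of [erase j] over [U] consists of [U] itself and its one-cell extensions by [j], so
    [w_step] sums it. *)
Let fiber_sum j U : partial_ext j U ->
  \sum_(V | partial_ext j.+1 V && (erase j V == U)) w j V = A j.
Proof.
move=> pU; rewrite -(w_step pU) (bigD1 U) /=; last first.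
  by rewrite partial_extW //= erase_id.
congr (_ + _).
have /partial_extP[tU aU lU] := pU.
rewrite (eq_bigl (fun V => V \in [set upd U c j | c in can_add U j])) => [|V].
  rewrite big_imset //= => c d /and3P[_ /eqP Uc _] /and3P[_ /eqP Ud _].
  move/ffunP/(_ c); rewrite !ffunE eqxx; case: eqP => // _.
  by rewrite Uc.
apply/idP/imsetP => [/andP[/andP[pV /eqP eV] VU]|[c /and3P[Lc /eqP Uc tV] ->]].
  have /partial_extP[tV aV lV] := pV.
  have [c /andP[Lc /eqP Vc]] : exists c, L c && (V c == Some j).
    apply/existsP; apply: contraR VU => /existsPn noj.
    apply/eqP; rewrite -eV; apply/ffunP => c; rewrite ffunE.
    by rewrite (negbTE (noj c)).
  have VE : V = upd U c j.
    apply/ffunP => x; rewrite -eV !ffunE; case: eqP => [->|xc] //.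
    case: ifP => // /andP[Lx /eqP Vx]; have /tableauP tt := tV.
    (* A second copy of [j] on the line would be comparable with the first, against strict
       increase. *)
    have [//|[|]] := lineL Lx Lc => h; exfalso.
      by have := tt _ _ _ _ h Vx Vc; rewrite ltnn.
    by have := tt _ _ _ _ h Vc Vx; rewrite ltnn.
  exists c => //; rewrite unfold_in /can_add Lc -VE tV andbT /=.
  by rewrite -eV ffunE Lc Vc eqxx.
apply/andP; split; last first.
  apply/eqP => /ffunP/(_ c); rewrite ffunE eqxx Uc //.
apply/andP; split.
  apply/partial_extP; split=> // x Lx; rewrite ffunE; case: eqP => [xc|_].
  - by rewrite xc Lc in Lx.
  - exact: aU.
  - by rewrite /= ltnSn.
  - by move/lU: Lx; case: (U x) => //= a /ltnW.
apply/eqP/ffunP => x; rewrite !ffunE; case: (eqVneq x c) => [->|xc].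
  by rewrite Lc eqxx Uc.
case: ifP => // /andP[/lU + /eqP Ux].
by rewrite Ux /= ltnn.
Qed.

Let partial_sum (m : nat) : (m <= T.-1)%N ->
  \sum_(V | partial_ext m V) \prod_(i : 'I_T.-1 | (i < m)%N) w i V
    = \prod_(i : 'I_T.-1 | (i < m)%N) A i.
Proof.
elim: m => [_|m IH lt_mT].
  rewrite (big_pred1 V0) => [|V]; first by rewrite !big_pred0.
  apply/idP/eqP => [/partial_extP[_ aV lV]|->]; last first.
    by apply/partial_extP; split=> // c /V0L ->.
  apply/ffunP => c; case Lc: (L c); last by rewrite aV ?Lc.
  by rewrite V0L //; have := lV _ Lc; case: (V c).
pose j := Ordinal lt_mT.
have splitj (F : 'I_T.-1 -> R) :
    \prod_(i : 'I_T.-1 | (i < m.+1)%N) F i = \prod_(i : 'I_T.-1 | (i < m)%N) F i * F j.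
  rewrite (bigD1 j) //= mulrC; congr (_ * _); apply: eq_bigl => i.
  rewrite ltnS ltn_neqAle andbC; congr (_ && _).
rewrite splitj -(IH (ltnW lt_mT)) big_distrl /=.
rewrite (partition_big (erase j) (partial_ext m)) => [|V]; last first.
  exact: (@partial_ext_erase j).
apply: eq_bigr => U pU; rewrite -(@fiber_sum j U) // big_distrr /=.
apply: eq_bigr => V /andP[pV /eqP eV]; rewrite splitj; congr (_ * _).
(* Erasing the value [m] is invisible to the smaller values [i]. *)
apply: eq_bigr => i im; apply: w_cut => c; rewrite -eV ffunE.
case: ifP => // /andP[_ /eqP ->] /=.
by rewrite leqNgt im.
Qed.

(* The values are put on the line in increasing order, so each summand is     *)
(* built by a sequence of independent steps, one for each value.              *)
Lemma line_sum :
  \sum_(V | is_tableau V && agree_off L V V0) \prod_i w i V = \prod_i A i.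
Proof.
have := partial_sum (leqnn _).
rewrite [RHS](eq_bigl xpredT) => [<-|i]; last exact: ltn_ord.
rewrite [RHS](eq_bigl (fun V => is_tableau V && agree_off L V V0)) => [|V].
  by apply: eq_bigr => V _; apply: eq_bigl => i; rewrite ltn_ord.
rewrite /partial_ext; congr (_ && _); rewrite andb_idr // => _.
by apply/forallP => c; apply/implyP => _; case: (V c) => //= a.
Qed.

End LineSum.
End Fillings.

(** * Column weights sum to one *)

Section Weights.
Variables (R : realFieldType) (z : nat -> R) (n T : nat).
Implicit Types (V U W : filling n T) (c d x : cell n) (i j a b : 'I_T.-1).
Implicit Types (k : 'I_n).

Lemma ysum_recr (m : nat) : ysum z m.+1 = ysum z m + z m.+1.
Proof. by rewrite /ysum big_nat_recr. Qed.

Lemma ysum_ord (m : nat) : ysum z m = \sum_(j < m) z (1 + j)%N.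
Proof. by rewrite /ysum big_add1 /= big_mkord; apply: eq_bigr. Qed.

(** The weight consults only column [k] and the columns to its right, and there only entries at most
    [i]. *)
Lemma Cweight_local V V' i k :
  (forall c, (k <= ccol c)%N -> cut i (V c) = cut i (V' c)) ->
  Cweight z V i k = Cweight z V' i k.
Proof.
move=> eqV.
have le_eq d : (k <= ccol d)%N -> entry_le V i d = entry_le V' i d.
  by move=> kd; rewrite !entry_le_cut eqV.
rewrite /Cweight (@eq_pick _ _ (fun c => (ccol c == k) && (V' c == Some i))); last first.
  move=> c /=; case: eqP => //= ck.
  by rewrite cut_eq_Some eqV ?ck // -cut_eq_Some.
case: pickP => [c /andP[/eqP ck _]|_].
  congr (z (1 + _)%N); apply: eq_card => x; rewrite !inE.
  case: (boolP (above c x)) => //= /andP[/eqP xc _]; congr (~~ _).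
  apply: eq_existsb => d; case: (boolP (right_of x d)) => //= /andP[_ xd].
  by rewrite le_eq // -ck -xc ltnW.
congr (1 - ysum z _); apply: eq_card => x; rewrite !inE.
case: eqP => //= xk; congr (~~ _).
apply: eq_existsb => d.
case: (boolP [|| _, _ | _]) => //= /or3P[/eqP->|/andP[_ xd]|/andP[/eqP xd _]].
- by rewrite le_eq // xk.
- by rewrite le_eq // -xk ltnW.
- by rewrite le_eq // xd xk.
Qed.

Lemma Cweight_some V i c : is_tableau V -> V c = Some i ->
  Cweight z V i (ccol c) = z (1 + free_above V i c)%N.
Proof.
move=> /tableauP tV Vc; rewrite /Cweight; case: pickP => [d|/(_ c)]; last first.
  by rewrite Vc !eqxx.
case/andP => /eqP dc /eqP Vd; suff -> : d = c by [].
apply: cell_eq; first by rewrite dc.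
case: (ltngtP (crow d) (crow c)) => // rdc.
  by have := tV d c i i; rewrite /above dc eqxx rdc orbT ltnn => /(_ isT Vd Vc).
by have := tV c d i i; rewrite /above dc eqxx rdc orbT ltnn => /(_ isT Vc Vd).
Qed.

Lemma Cweight_none V i k : (forall c, ccol c = k -> V c <> Some i) ->
  Cweight z V i k = 1 - ysum z (free_in_col V i k).
Proof.
move=> noi; rewrite /Cweight; case: pickP => // c /andP[/eqP /noi + /eqP].
by move=> h /h.
Qed.

Definition free_cell V i x : bool :=
  ~~ [exists d, [|| d == x, right_of x d | above x d] && entry_le V i d].

Lemma free_cellP V i x :
  reflect (forall d, [|| d == x, right_of x d | above x d] ->
             ~~ entry_le V i d) (free_cell V i x).
Proof.
apply: (iffP existsPn) => [H d xd|H d].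
  by have := H d; rewrite xd.
by rewrite negb_and -implybE; apply/implyP => /H.
Qed.

Lemma line_column k : line [pred c | ccol c == k].
Proof.
move=> c d /eqP ck /eqP dk; rewrite /above ck dk eqxx /=.
case: (ltngtP (crow c) (crow d)) => [||rcd]; rewrite ?orbT; auto.
by left; apply: cell_eq => //; rewrite ck dk.
Qed.

Lemma upd_tableau U j c : is_tableau U ->
  (forall d a, right_of c d || above c d -> U d = Some a -> (j < a)%N) ->
  (forall d a, right_of d c || above d c -> U d = Some a -> (a < j)%N) ->
  is_tableau (upd U c j).
Proof.
move=> /tableauP tU Hr Hl; apply/tableauP => x y a b xy; rewrite !ffunE.
case: eqP => [xc|_]; case: eqP => [yc|_].
- by move: xy; rewrite xc yc /right_of /above !ltnn !andbF.
- by move=> [<-] Uy; apply: (Hr y) => //; rewrite -xc.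
- by move=> Ux [<-]; apply: (Hl x) => //; rewrite -yc.
- exact: tU.
Qed.

Lemma free_cell_addable U j c :
  is_tableau (upd U c j) -> U c = None -> free_cell U j c.
Proof.
move=> /tableauP tU Uc; apply/free_cellP => d; rewrite /entry_le.
case: eqP => [-> _|dc /= cd]; first by rewrite Uc.
case Ud: (U d) => [a|//]; rewrite -ltnNge; apply: (tU c d _ _ cd).
  by rewrite ffunE eqxx.
by rewrite ffunE; case: eqP.
Qed.

(** Once everything to the left and below is smaller than [j], the only obstruction is an entry at
    most [j] in the cell, to its right or above it. *)
Lemma can_add_free (L : pred (cell n)) V0 U j c : L c ->
  partial_ext L V0 j U ->
  (forall d a, right_of d c || above d c -> U d = Some a -> (a < j)%N) ->
  can_add L U j c = free_cell U j c.
Proof.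
move=> Lc /partial_extP[tU _ lU] Hl; rewrite /can_add Lc /=.
apply/andP/idP => [[/eqP Uc tV]|/free_cellP fc].
  exact: free_cell_addable.
have Uc : U c = None.
  have := fc c; rewrite eqxx /= /entry_le => /(_ isT); have := lU c Lc.
  by case: (U c) => //= a /ltnW ->.
split; first by rewrite Uc.
apply: upd_tableau => // d a cd Ud; have := fc d.
by rewrite cd orbT /entry_le Ud -ltnNge => /(_ isT).
Qed.

Lemma column_sum V0 k : is_tableau V0 ->
  (forall c, (ccol c <= k)%N -> V0 c = None) ->
  \sum_(V | is_tableau V && agree_off [pred c | ccol c == k] V V0)
    \prod_i Cweight z V i k = 1.
Proof.
move=> tV0 V0e; transitivity (\prod_(i < T.-1) (1 : R)); last by rewrite big1.
apply: (@line_sum _ _ _ _ _ (fun i V => Cweight z V i k) (fun=> 1)) => //.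
- exact: line_column.
- by move=> c /eqP ck; rewrite V0e ?ck.
- by move=> i V V' eqV; apply: Cweight_local => c _.
move=> j U pU; have /partial_extP[tU aU lU] := pU.
have left_empty c d a : ccol c = k -> right_of d c || above d c ->
    U d = Some a -> (a < j)%N.
  move=> ck cd Ud; case dk: (ccol d == k).
    by have := lU d; rewrite /= dk Ud => /(_ isT).
  rewrite aU /= ?dk // V0e // in Ud.
  case/orP: cd => /andP[]; first by rewrite ck => _ /ltnW.
  by rewrite ck eq_sym dk.
have no_j c : ccol c = k -> U c <> Some j.
  move=> ck Uc; have := lU c; rewrite /= ck eqxx Uc /= ltnn.
  by move=> /(_ isT).
pose G := [set x : cell n | ccol x == k & free_cell U j x].
rewrite (@Cweight_none U) // -/G.
have -> : free_in_col U j k = #|G| by [].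
rewrite (eq_bigl (mem G)) => [|c]; last first.
  rewrite /= inE; case ck: (ccol c == k) => /=; last first.
    by rewrite /can_add /= ck.
  by rewrite (@can_add_free _ V0) //= => d a; apply: left_empty; apply/eqP.
suff -> : \sum_(c in G) Cweight z (upd U c j) j k = ysum z #|G| by rewrite subrK.
rewrite ysum_ord.
rewrite -(@sum_rank _ _ (fun c => crow c : nat) G (fun m => z (1 + m)%N)); last first.
  move=> x y; rewrite !inE => /andP[/eqP xk _] /andP[/eqP yk _] rxy.
  by apply: cell_eq; rewrite ?xk ?yk.
apply: eq_bigr => c; rewrite inE => /andP[/eqP ck fc].
have tV : is_tableau (upd U c j).
  have := @can_add_free _ _ _ _ c _ pU; rewrite /= ck eqxx => /(_ isT) h.
  by move: fc; rewrite -h => [/and3P[]|d a] //; apply: left_empty.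
have Vc : upd U c j c = Some j by rewrite ffunE eqxx.
(* As [c] is free, column [k] has no entry at most [j] above [c]; there the condition counted by
   [free_above] coincides with [free_cell]. *)
rewrite -{1}ck (Cweight_some tV Vc); congr (z (1 + _)%N).
apply: eq_card => x; rewrite !inE /above ck.
case: eqP => //= xk; case rcx: (_ < _)%N; rewrite ?andbF ?andbT //=.
move/free_cellP: fc => fc.
apply/existsPn/free_cellP => H d.
  case/or3P => [/eqP ->|xd|/andP[/eqP dx xd]].
  - by apply: fc; rewrite /above ck xk eqxx rcx !orbT.
  - have := H d; rewrite xd /= /entry_le ffunE; case: eqP => // ->.
    by rewrite leqnn.
  - by apply: fc; rewrite /above ck dx xk eqxx (ltn_trans rcx xd) !orbT.
rewrite negb_and; case xd: (right_of x d) => //=.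
have := H d; rewrite xd orbT /= => /(_ isT); rewrite /entry_le ffunE.
case: eqP => // dc; move: xd; rewrite /right_of dc ck xk ltnn andbF //.
Qed.

End Weights.

(** * Summing over the bottom row *)

Section BottomRow.
Variables (R : realFieldType) (z : nat -> R) (n T : nat).
Implicit Types (V U W : filling n T) (c d x : cell n) (i j a b : 'I_T.-1).
Implicit Types (k : 'I_n).

Definition bottom k : cell n :=
  exist (fun c : 'I_n * 'I_n => (c.1 + c.2 < n)%N)
    (k, Ordinal (leq_ltn_trans (leq0n k) (ltn_ord k)))
    (eq_ind_r (fun m => (m < n)%N) (ltn_ord k) (addn0 k)).

Definition in_bottom : pred (cell n) := [pred c | crow c == 0%N :> nat].

Lemma bottomK c : in_bottom c -> bottom (ccol c) = c.
Proof. by move/eqP => c0; apply: cell_eq => //; rewrite c0. Qed.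

Lemma line_bottom : line in_bottom.
Proof.
move=> c d /eqP c0 /eqP d0; rewrite /right_of /= -!(inj_eq val_inj) /= c0 d0 /=.
case: (ltngtP (ccol c) (ccol d)) => [||kcd]; rewrite ?orbT; auto.
by left; apply: cell_eq; rewrite ?c0 ?d0.
Qed.

Definition top_free V i k : {set cell n} :=
  [set x : cell n | [&& ccol x == k, (0 < crow x)%N & free_cell V i x]].

(* The weight [Cweight] that column k has once the bottom row is deleted.     *)
Definition Tweight V i k : R :=
  if [pick c : cell n | [&& ccol c == k, (0 < crow c)%N & V c == Some i]]
    is Some c
  then z (1 + free_above V i c)%N
  else 1 - ysum z #|top_free V i k|.

Lemma Tweight_none V i k :
  (forall c, ccol c = k -> (0 < crow c)%N -> V c <> Some i) ->
  Tweight V i k = 1 - ysum z #|top_free V i k|.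
Proof.
move=> noi; rewrite /Tweight; case: pickP => // c /and3P[/eqP ck c0 /eqP].
by move=> /(noi c ck c0).
Qed.

Let entry_le_agree V V' i (P : pred (cell n)) x :
  (forall c, (0 < crow c)%N -> V c = V' c) -> (0 < crow x)%N ->
  (forall d, P d -> (crow x <= crow d)%N) ->
  [exists d, P d && entry_le V i d] = [exists d, P d && entry_le V' i d].
Proof.
move=> eqV x0 xP; apply: eq_existsb => d; case Pd: (P d) => //=.
by rewrite /entry_le eqV // (leq_trans x0) // xP.
Qed.

Lemma top_free_agree V V' i k :
  (forall c, (0 < crow c)%N -> V c = V' c) -> top_free V i k = top_free V' i k.
Proof.
move=> eqV; apply/setP => x; rewrite !inE.
case: eqP => //= _; case: ltnP => //= x0; congr (~~ _).
apply: (entry_le_agree _ eqV x0) => d.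
by case/or3P => [/eqP ->|/andP[/eqP -> _]|/andP[_ /ltnW]].
Qed.

(** A cell above the bottom row is affected only by its own row and by higher cells of its
    column. *)
Lemma Tweight_agree V V' i k :
  (forall c, (0 < crow c)%N -> V c = V' c) -> Tweight V i k = Tweight V' i k.
Proof.
move=> eqV; rewrite /Tweight (top_free_agree _ _ eqV) (@eq_pick _ _
  (fun c => [&& ccol c == k, (0 < crow c)%N & V' c == Some i])); last first.
  by move=> c /=; case: eqP => //= _; case: ltnP => //= c0; rewrite eqV.
case: pickP => [c /and3P[_ c0 _]|//].
congr (z (1 + _)%N); apply: eq_card => x; rewrite !inE.
case: (boolP (above c x)) => //= /andP[_ cx]; congr (~~ _).
apply: (@entry_le_agree _ _ _ _ x eqV); first exact: leq_trans c0 (ltnW cx).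
by move=> d /andP[/eqP ->].
Qed.

Lemma free_in_colE V i k :
  free_in_col V i k = (free_cell V i (bottom k) + #|top_free V i k|)%N.
Proof.
rewrite /free_in_col (cardsD1 (bottom k)) inE eqxx /=; congr (_ + _)%N.
apply: eq_card => x; rewrite !inE /free_cell.
case: (ccol x =P k) => [xk|_] /=; last by rewrite andbF.
congr (_ && _); rewrite lt0n; congr (~~ _); apply/eqP/eqP => [->|x0] //.
by rewrite -xk bottomK //; apply/eqP.
Qed.

Lemma free_above_bottom V i k :
  (forall d, above (bottom k) d -> ~~ entry_le V i d) ->
  free_above V i (bottom k) = #|top_free V i k|.
Proof.
move=> clean; apply: eq_card => x; rewrite !inE /above.
have -> : (ccol (bottom k)) = k by [].
case: eqP => //= xk.
case: ltnP => //= x0; apply/existsPn/free_cellP => H d.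
  case/or3P => [/eqP ->|xd|/andP[/eqP dx xd]].
  - by apply: clean; rewrite /above xk eqxx.
  - by have := H d; rewrite xd.
  - by apply: clean; rewrite /above dx xk eqxx /= (ltn_trans x0 xd).
by rewrite negb_and -implybE; apply/implyP => xd; apply: H; rewrite xd orbT.
Qed.

Lemma Cweight_top V i k : is_tableau V -> V (bottom k) <> Some i ->
  ~~ free_cell V i (bottom k) -> Cweight z V i k = Tweight V i k.
Proof.
move=> tV Vk /negbTE nf; rewrite /Tweight.
case: pickP => [c /and3P[/eqP <- _ /eqP]|noi]; first exact: Cweight_some.
rewrite Cweight_none ?free_in_colE ?nf // => c ck Vc.
have := noi c; rewrite ck Vc !eqxx andbT /= lt0n => /negbT.
by rewrite negbK => /bottomK bc; apply: Vk; rewrite -ck bc.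
Qed.

(** Telescoping with a_k = [Tweight V0 j k] and b_k = [Cweight z U j k]: these differ only if the
    bottom cell of column k is free, and then a_k - b_k is the weight of [j] placed there. *)
Lemma row_sum V0 : is_tableau V0 -> (forall c, in_bottom c -> V0 c = None) ->
  \sum_(V | is_tableau V && agree_off in_bottom V V0)
    \prod_i \prod_k Cweight z V i k = \prod_i \prod_k Tweight V0 i k.
Proof.
move=> tV0 V0e.
apply: (@line_sum _ _ _ _ _ (fun i V => \prod_k Cweight z V i k)
          (fun i => \prod_k Tweight V0 i k)) => //.
- exact: line_bottom.
- by move=> i V V' eqV; apply: eq_bigr => k _; apply: Cweight_local => c _.
move=> j U pU; have /partial_extP[tU aU lU] := pU.
have UT k : Tweight U j k = Tweight V0 j k.
  by apply: Tweight_agree => c c0; apply: aU; rewrite /= -lt0n.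
have left_lt k d a : right_of d (bottom k) || above d (bottom k) ->
    U d = Some a -> (a < j)%N.
  case/orP => /andP[]; last by rewrite ltn0.
  move=> /eqP dk _ Ud; have := lU d; rewrite Ud; apply.
  by rewrite /in_bottom /= -dk.
have no_j k : U (bottom k) <> Some j.
  by move=> Uk; have := lU (bottom k); rewrite Uk /= ltnn => /(_ isT).
have addE k : can_add in_bottom U j (bottom k) = free_cell U j (bottom k).
  by apply: (@can_add_free _ _ _ V0) => // d a; apply: left_lt.
rewrite -(prod_telescope (Tweight V0 j) (Cweight z U j)); congr (_ + _).
rewrite (reindex_onto bottom (@ccol n)) => [|c /and3P[c0 _ _]]; last first.
  exact: bottomK.
(* The telescoping sum runs over all columns; one whose bottom cell is not free has a zero factor
   a_c - b_c. *)
rewrite big_mkcond /=; apply: eq_bigr => c _.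
rewrite eqxx andbT addE; case: ifPn => [fc|nf]; last first.
  rewrite (bigD1 c) //= ltnn eqxx.
  by rewrite (Cweight_top tU) // UT subrr mul0r.
have tV : is_tableau (upd U (bottom c) j) by move: fc; rewrite -addE => /and3P[].
have VU x : (0 < crow x)%N -> upd U (bottom c) j x = U x.
  by move=> x0; rewrite ffunE; case: eqP => // xc; rewrite xc in x0.
have VT k : Tweight (upd U (bottom c) j) j k = Tweight V0 j k.
  by rewrite -UT; apply: Tweight_agree.
(* To the left of [c] the new [j] makes the bottom cells not free, giving a_k; to the right of [c]
   nothing changes, giving b_k. *)
apply: eq_bigr => k _; case: ltngtP => [kc|ck|kc].
- rewrite Cweight_top ?VT //.
    rewrite ffunE; case: eqP => // kc'.
    by have kc2 : k = c := congr1 (@ccol n) kc'; rewrite kc2 ltnn in kc.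
  apply/free_cellP => /(_ (bottom c)); rewrite /entry_le ffunE eqxx leqnn.
  by move=> H; have := H; rewrite /right_of kc -!(inj_eq val_inj) /= orbT => /(_ isT).
- case: eqP => [kc|_]; first by rewrite kc ltnn in ck.
  apply: Cweight_local => x kx; rewrite ffunE; case: eqP => // xc.
  by rewrite xc leqNgt ck in kx.
have {kc} -> : k = c by apply: val_inj.
rewrite eqxx.
have clean d : above (bottom c) d -> ~~ entry_le U j d.
  by move=> cd; move/free_cellP: fc; apply; rewrite cd !orbT.
have Vc : upd U (bottom c) j (bottom c) = Some j by rewrite ffunE eqxx.
have -> : Cweight z (upd U (bottom c) j) j c = _ := Cweight_some z tV Vc.
rewrite free_above_bottom; last first.
  move=> d cd; rewrite /entry_le ffunE; case: eqP => [dc|_]; last exact: clean.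
  by move: cd; rewrite dc /above ltnn andbF.
rewrite (top_free_agree _ _ VU) -UT Tweight_none; last first.
  move=> x xc x0 Ux; have := clean x; rewrite /above xc eqxx x0 /entry_le Ux leqnn.
  by move=> /(_ isT).
rewrite Cweight_none => [|x xc Ux]; last first.
  have [x0|x0] := posnP (crow x).
    by apply: (no_j c); rewrite -xc bottomK //; apply/eqP.
  have := clean x; rewrite /above xc eqxx x0 /entry_le Ux leqnn.
  by move=> /(_ isT).
rewrite free_in_colE fc /= add1n ysum_recr opprB addrC.
by rewrite addrA subrK addrAC subrr add0r.
Qed.

End BottomRow.

(** * The diagonal move between consecutive states *)

Section Shift.
Variables n T : nat.
Implicit Types (V U W : filling n T) (c d x y : cell n) (i j a b : 'I_T.-1).

Lemma exists_cell (k r : nat) : (k + r < n)%N ->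
  exists c : cell n, ccol c = k :> nat /\ crow c = r :> nat.
Proof.
move=> kr; have kn := leq_ltn_trans (leq_addr r k) kr.
have rn := leq_ltn_trans (leq_addl k r) kr.
by exists (exist (fun c : 'I_n * 'I_n => (c.1 + c.2 < n)%N)
             (Ordinal kn, Ordinal rn) kr).
Qed.

Lemma cell_lt c : (ccol c + crow c < n)%N.
Proof. exact: valP c. Qed.

Definition diag c d : bool :=
  (ccol d == (ccol c).+1 :> nat) && (crow c == (crow d).+1 :> nat).

(** The default value is returned only on the bottom row, and for [up_left] only on the first
    column. *)
Definition down_right c : cell n := odflt c [pick d | diag c d].
Definition up_left d : cell n := odflt d [pick c | diag c d].

Lemma diag_down_right c : (0 < crow c)%N -> diag c (down_right c).
Proof.
move=> c0; rewrite /down_right; case: pickP => //= noD.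
have [|d [dk dr]] := @exists_cell (ccol c).+1 (crow c).-1.
  by rewrite addSnnS prednK // cell_lt.
by have := noD d; rewrite /diag dk dr prednK // !eqxx.
Qed.

Lemma diag_up_left d : (0 < ccol d)%N -> diag (up_left d) d.
Proof.
move=> d0; rewrite /up_left; case: pickP => //= noC.
have [|c [ck cr]] := @exists_cell (ccol d).-1 (crow d).+1.
  by rewrite addnS -addSn prednK // cell_lt.
by have := noC c; rewrite /diag ck cr prednK // !eqxx.
Qed.

Lemma diag_injl c c' d : diag c d -> diag c' d -> c = c'.
Proof.
case/andP => /eqP k1 /eqP r1 /andP[/eqP k2 /eqP r2].
by apply: cell_eq; [apply: succn_inj; rewrite -k1 -k2|rewrite r1 r2].
Qed.

Lemma diag_injr c d d' : diag c d -> diag c d' -> d = d'.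
Proof.
case/andP => /eqP k1 /eqP r1 /andP[/eqP k2 /eqP r2].
by apply: cell_eq; [rewrite k1 k2|apply: succn_inj; rewrite -r1 -r2].
Qed.

Lemma diag_row c d : diag c d -> (0 < crow c)%N.
Proof. by case/andP => _ /eqP ->. Qed.

Lemma diag_col c d : diag c d -> (0 < ccol d)%N.
Proof. by case/andP => /eqP ->. Qed.

Lemma up_leftK y : (0 < ccol y)%N -> down_right (up_left y) = y.
Proof.
move=> y0; have yd := diag_up_left y0.
exact: diag_injr (diag_down_right (diag_row yd)) yd.
Qed.

Lemma down_rightK x : (0 < crow x)%N -> up_left (down_right x) = x.
Proof.
move=> x0; have xd := diag_down_right x0.
exact: diag_injl (diag_up_left (diag_col xd)) xd.
Qed.

Lemma diag_right_of c c' d d' : diag c d -> diag c' d' ->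
  right_of c c' = right_of d d'.
Proof.
case/andP => /eqP k1 /eqP r1 /andP[/eqP k2 /eqP r2].
by rewrite /right_of -!(inj_eq val_inj) /= r1 r2 k1 k2 eqSS ltnS.
Qed.

Lemma diag_above c c' d d' : diag c d -> diag c' d' ->
  above c c' = above d d'.
Proof.
case/andP => /eqP k1 /eqP r1 /andP[/eqP k2 /eqP r2].
by rewrite /above -!(inj_eq val_inj) /= r1 r2 k1 k2 eqSS ltnS.
Qed.

Definition shift V : filling n T :=
  [ffun d => if (0 < ccol d)%N then V (up_left d) else None].

Definition unshift W : filling n T :=
  [ffun c => if (0 < crow c)%N then W (down_right c) else None].

Lemma shift_tableau V : is_tableau V -> is_tableau (shift V).
Proof.
move=> /tableauP tV; apply/tableauP => c d a b cd; rewrite !ffunE.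
case: ltnP => // c0; case: ltnP => // d0; apply: tV.
rewrite (diag_right_of (diag_up_left c0) (diag_up_left d0)).
by rewrite (diag_above (diag_up_left c0) (diag_up_left d0)).
Qed.

Lemma unshift_tableau W : is_tableau W -> is_tableau (unshift W).
Proof.
move=> /tableauP tW; apply/tableauP => c d a b cd; rewrite !ffunE.
case: ltnP => // c0; case: ltnP => // d0; apply: tW.
rewrite -(diag_right_of (diag_down_right c0) (diag_down_right d0)).
by rewrite -(diag_above (diag_down_right c0) (diag_down_right d0)).
Qed.

Lemma shift_compatibleP V W :
  reflect (forall c d, diag c d -> W d = V c) (shift_compatible V W).
Proof.
apply: (iffP forallP) => [H c d cd|H c].
  by move: (H c) => /forallP/(_ d)/implyP/(_ cd)/eqP.
by apply/forallP => d; apply/implyP => /H ->.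
Qed.

(** The successors of [V] are the refillings of one column, the form needed for [column_sum]. *)
Lemma shift_compatible_shift V W :
  shift_compatible V W = agree_off [pred d | ccol d == 0%N :> nat] W (shift V).
Proof.
apply/shift_compatibleP/agree_offP => H => [d|c d cd].
  by rewrite /= -lt0n => d0; rewrite ffunE d0; apply/H/diag_up_left.
have d0 := diag_col cd; rewrite H /= -?lt0n // ffunE d0.
by rewrite (diag_injl (diag_up_left d0) cd).
Qed.

(** The predecessors of [W] are the refillings of the bottom row, the form needed for [row_sum]. *)
Lemma shift_compatible_unshift V W :
  shift_compatible V W = agree_off (@in_bottom n) V (unshift W).
Proof.
apply/shift_compatibleP/agree_offP => H => [c|c d cd].
  rewrite /= -lt0n => c0; rewrite ffunE c0.
  by rewrite -(H _ _ (diag_down_right c0)).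
have c0 := diag_row cd; rewrite H /in_bottom /= -?lt0n // ffunE c0.
by rewrite (diag_injr (diag_down_right c0) cd).
Qed.

Section Transfer.
Variables P P' : pred (cell n).
Hypothesis P_row : forall x, P x -> (0 < crow x)%N.
Hypothesis P'_col : forall y, P' y -> (0 < ccol y)%N.
Hypothesis P_diag : forall x y, diag x y -> P x = P' y.

(** [down_right] is a bijection between the two sets, with inverse [up_left]. *)
Lemma card_diag : #|[set x | P x]| = #|[set y | P' y]|.
Proof.
rewrite -(@card_in_imset _ _ down_right [set x | P x]) => [|x y]; last first.
  rewrite !inE => /P_row x0 /P_row y0 e.
  by rewrite -(down_rightK x0) e down_rightK.
apply: eq_card => y; rewrite inE; apply/imsetP/idP => [[x]|Py].
  by rewrite inE => Px ->; rewrite -(P_diag (diag_down_right (P_row Px))).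
exists (up_left y); last by rewrite up_leftK // P'_col.
by rewrite inE (P_diag (diag_up_left (P'_col Py))).
Qed.

Lemma exists_entry_diag W i :
  [exists x, P x && entry_le (unshift W) i x]
    = [exists y, P' y && entry_le W i y].
Proof.
apply/existsP/existsP => [[x /andP[Px]]|[y /andP[Py Wy]]].
  have x0 := P_row Px; rewrite /entry_le ffunE x0 => Wx.
  by exists (down_right x); rewrite -(P_diag (diag_down_right x0)) Px.
have yd := diag_up_left (P'_col Py); exists (up_left y).
by rewrite (P_diag yd) Py /entry_le ffunE (diag_row yd) up_leftK ?P'_col.
Qed.

End Transfer.

Lemma right_of_row x d : right_of x d -> crow d = crow x :> nat.
Proof. by case/andP => /eqP ->. Qed.

Lemma free_above_unshift W i c d : diag c d ->
  free_above (unshift W) i c = free_above W i d.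
Proof.
move=> cd; apply: card_diag => [x|y|x y xy].
- by case/andP => /andP[_ cx] _; apply: leq_ltn_trans cx.
- by case/andP => /andP[/eqP -> _] _; apply: diag_col cd.
rewrite (diag_above cd xy) (@exists_entry_diag _ (right_of y)) //.
- by move=> v /right_of_row ->; apply: diag_row xy.
- by move=> v /andP[_]; apply: leq_ltn_trans.
- by move=> u v uv; apply: diag_right_of.
Qed.

Lemma top_free_unshift W i (k k' : 'I_n) : k' = k.+1 :> nat ->
  #|top_free (unshift W) i k| = free_in_col W i k'.
Proof.
move=> kk'; apply: card_diag => [x|y|x y xy].
- by case/and3P.
- by case/andP => /eqP -> _; rewrite kk'.
rewrite (diag_row xy) /=; congr (_ && _).
  by case/andP: xy => /eqP xy _; rewrite -!(inj_eq val_inj) /= xy kk' eqSS.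
rewrite /free_cell.
rewrite (@exists_entry_diag _ (fun d => [|| d == y, right_of y d | above y d])) //.
- move=> v /or3P[/eqP ->|/right_of_row ->|/andP[_]]; try exact: diag_row xy.
  exact: leq_ltn_trans.
- move=> v /or3P[/eqP ->|/andP[_]|/andP[/eqP -> _]]; try exact: diag_col xy.
  exact: leq_ltn_trans.
- move=> u v uv; rewrite (diag_right_of xy uv) (diag_above xy uv).
  congr (_ || _); apply/eqP/eqP => e.
    by rewrite e in uv; apply: diag_injr uv xy.
  by rewrite e in uv; apply: diag_injl uv xy.
Qed.

(** Without its bottom cell, column [k] of a predecessor is the next column of [W], and the move
    preserves the relations that define the free cells. *)
Lemma Tweight_unshift (R : realFieldType) (z : nat -> R) W i (k k' : 'I_n) :
  is_tableau W -> k' = k.+1 :> nat ->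
  Tweight z (unshift W) i k = Cweight z W i k'.
Proof.
move=> tW kk'; rewrite /Tweight; case: pickP => [c /and3P[/eqP ck c0]|noi].
  rewrite ffunE c0 => /eqP Wc; have cd := diag_down_right c0.
  have -> : k' = ccol (down_right c).
    by apply: val_inj; case/andP: cd => /eqP /= -> _; rewrite kk' ck.
  by rewrite (Cweight_some z tW Wc) (free_above_unshift _ _ cd).
rewrite (top_free_unshift W i kk') Cweight_none // => d dk Wd.
have d0 : (0 < ccol d)%N by rewrite dk kk'.
have cd := diag_up_left d0.
have := noi (up_left d); rewrite (diag_row cd) ffunE (diag_row cd) up_leftK //.
rewrite Wd eqxx !andbT => /negbT/eqP; apply; apply: val_inj.
by case/andP: cd => /eqP; rewrite dk kk' => -[].
Qed.

End Shift.

Lemma sum_tableau (R : nmodType) (n T : nat) (P : pred (filling n T))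
    (F : filling n T -> R) :
  \sum_(V : tableau n T | P (val V)) F (val V)
    = \sum_(V | is_tableau V && P V) F V.
Proof.
rewrite [RHS](reindex_omap (val : tableau n T -> filling n T) insub).
  apply: eq_bigl => V; rewrite (valP V) valK eqxx andbT //.
by move=> V /andP[tV _]; rewrite insubT.
Qed.

(** * Total mass, column by column *)

Section TotalMass.
Variables (R : realFieldType) (z : nat -> R) (n T : nat).
Implicit Types (V U W : filling n T) (c d x y : cell n).

Definition cols_empty (m : nat) V : bool :=
  [forall c, (ccol c < m)%N ==> (V c == None)].

Lemma cols_emptyP (m : nat) V :
  reflect (forall c, (ccol c < m)%N -> V c = None) (cols_empty m V).
Proof.
apply: (iffP forallP) => [H c /(implyP (H c))/eqP //|H c].
by apply/implyP => /H ->.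
Qed.

Let mass (m : nat) : R :=
  \sum_(V | is_tableau V && cols_empty m V)
    \prod_(k < n | (m <= k)%N) \prod_i Cweight z V i k.

Let erase_col (k : 'I_n) V : filling n T :=
  [ffun c => if ccol c == k then None else V c].

(** Columns to the right of [k] do not see column [k], so its fillings can be summed separately,
    with total 1. *)
Let massS (k : 'I_n) : mass k = mass k.+1.
Proof.
rewrite /mass (partition_big (erase_col k)
  (fun U => is_tableau U && cols_empty k.+1 U)) => [|V]; last first.
  case/andP => /tableauP tV /cols_emptyP eV; apply/andP; split.
    apply/tableauP => c d a b cd; rewrite !ffunE.
    by case: ifP => // _ Vc; case: ifP => // _ Vd; apply: (tV c d).
  apply/cols_emptyP => c; rewrite ffunE ltnS leq_eqVlt -val_eqE /=.
  by case: eqVneq => //= _ ck; apply: eV.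
apply: eq_bigr => U /andP[tU /cols_emptyP eU].
rewrite -[RHS]mul1r -[X in _ = X * _](@column_sum R z n T U k) //.
rewrite big_distrl /=.
rewrite (eq_bigl (fun V => is_tableau V && agree_off [pred c | ccol c == k] V U)).
  apply: eq_bigr => V /andP[_ /agree_offP aV].
  rewrite (bigD1 k) //=; congr (_ * _); apply: eq_big => [k'|k' /andP[kk' k'k]].
    by rewrite ltn_neqAle andbC eq_sym.
  apply: eq_bigr => i _; apply: Cweight_local => c kc; rewrite aV //=.
  apply: contraNneq k'k => ck; rewrite -val_eqE eqn_leq kk' andbT /=.
  by rewrite -ck.
move=> V; rewrite -andbA; case tV: (is_tableau V) => //=.
apply/andP/agree_offP => [[_ /eqP <-] c /= /negbTE ck|aV]; first by rewrite ffunE ck.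
split.
  apply/cols_emptyP => c ck; rewrite aV ?eU ?ltnS 1?ltnW //=.
  by apply/eqP => e; rewrite e ltnn in ck.
apply/eqP/ffunP => c; rewrite ffunE; case: eqP => [ck|/eqP ck].
  by rewrite eU // ck.
exact: aV.
Qed.

Lemma total_mass : \sum_(V : tableau n T) PiT z V = 1.
Proof.
have -> : \sum_(V : tableau n T) PiT z V = mass 0.
  rewrite [LHS](@sum_tableau _ n T xpredT
    (fun V => \prod_(k < n) \prod_i Cweight z V i k)).
  apply: eq_bigl => V; congr (_ && _).
  by apply/esym/cols_emptyP.
have -> : mass 0 = mass n.
  suff H (m : nat) : (m <= n)%N -> mass 0 = mass m by exact: H.
  by elim: m => // m IH mn; rewrite (IH (ltnW mn)) -(massS (Ordinal mn)).
rewrite /mass (big_pred1 [ffun=> None]) => [|V].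
  by rewrite big_pred0 // => k; rewrite leqNgt ltn_ord.
apply/andP/eqP => [[_ /cols_emptyP eV]|->].
  by apply/ffunP => c; rewrite ffunE eV.
split; last by apply/cols_emptyP => c _; rewrite ffunE.
by apply/tableauP => c d a b _; rewrite ffunE.
Qed.

End TotalMass.

(** * Positivity of the weights *)

Section Positivity.
Variables (R : realFieldType) (z : nat -> R) (n T : nat).
Hypothesis z_gt0 : forall j : nat, (1 <= j <= n.+1)%N -> 0 < z j.
Hypothesis z_sum : \sum_(1 <= j < n.+2) z j = 1.

Lemma ysum_lt1 (m : nat) : (m <= n)%N -> ysum z m < 1.
Proof.
move=> mn; rewrite -z_sum /ysum [X in _ < X](@big_cat_nat _ _ _ m.+1) ?ltnS ?leqW //=.
rewrite ltrDl big_nat_recr //=; apply: ltr_wpDl; last by rewrite z_gt0 /=.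
rewrite big_nat_cond sumr_ge0 // => j /andP[/andP[mj jn] _].
by rewrite ltW // z_gt0 // (leq_ltn_trans _ mj) //= ltnW.
Qed.

Lemma card_column (k : 'I_n) : (#|[set x : cell n | ccol x == k]| <= n)%N.
Proof.
rewrite -[X in (_ <= X)%N]card_ord -(@card_in_imset _ _ (@crow n)).
  exact: max_card.
move=> x y; rewrite !inE => /eqP xk /eqP yk e.
by apply: cell_eq; rewrite ?xk ?yk ?e.
Qed.

(** A column has at most [n] cells, so only z_1, ..., z_(n+1) and y_0, ..., y_n occur; each such y_m
    omits the positive z_(n+1) and is below 1. *)
Lemma Cweight_gt0 (V : filling n T) i k : 0 < Cweight z V i k.
Proof.
rewrite /Cweight; case: pickP => [c /andP[ck _]|_].
  apply: z_gt0; rewrite add1n /= ltnS; apply: leq_trans (card_column k).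
  apply/ltnW/proper_card/properP; split.
    apply/subsetP => x; rewrite !inE => /andP[/andP[/eqP -> _] _].
    exact: ck.
  by exists c; rewrite !inE ?ck // /above ltnn andbF.
rewrite subr_gt0 ysum_lt1 //; apply: leq_trans (card_column k).
by apply/subset_leq_card/subsetP => x; rewrite !inE => /andP[].
Qed.

End Positivity.

Theorem theorem3p10 (R : realFieldType) (n T : nat) (z : nat -> R)
    (n_ge1 : (1 <= n)%N) (T_ge1 : (1 <= T)%N)
    (z_gt0 : forall j : nat, (1 <= j <= n.+1)%N -> 0 < z j)
    (z_sum : \sum_(1 <= j < n.+2) z j = 1) :
  [/\ stochastic (@trans R z n T),
      \sum_(V : tableau n T) PiT z V
        = (\sum_(1 <= j < n.+2) z j) ^+ (n * (T - 1)),
      (\sum_(1 <= j < n.+2) z j) ^+ (n * (T - 1)) = 1,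
      stationary_distribution (@trans R z n T) (@PiT R z n T)
    & forall mu : tableau n T -> R,
        stationary_distribution (@trans R z n T) mu ->
        forall V : tableau n T, mu V = PiT z V].
Proof.
case: n n_ge1 z_gt0 z_sum => // n _ z_gt0 z_sum.
have C_gt0 (V : filling n.+1 T) i k : 0 < Cweight z V i k.
  exact: Cweight_gt0.
pose col0 (W : filling n.+1 T) := \prod_(i < T.-1) Cweight z W i ord0.
have transE (V W : tableau n.+1 T) : trans z V W =
    if shift_compatible (val V) (val W) then col0 (val W) else 0.
  rewrite /trans; case: ifP => // _; exact: big_pred1.
have stoch : stochastic (@trans R z n.+1 T).
  split=> [V W|V].
    by rewrite transE; case: ifP => // _; apply: prodr_ge0 => i _; apply: ltW.
  under eq_bigr do rewrite transE; rewrite -big_mkcond /=.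
  rewrite (@sum_tableau _ _ _ (shift_compatible (val V)) col0).
  rewrite -[RHS](@column_sum R z n.+1 T (shift (val V)) ord0) //.
  - by apply: eq_bigl => W; rewrite shift_compatible_shift.
  - exact/shift_tableau/valP.
  - by move=> c; rewrite leqn0 ffunE => /eqP ->.
have stat : stationary_distribution (@trans R z n.+1 T) (@PiT R z n.+1 T).
  split=> [V||W]; last 1 first.
  - under eq_bigr do rewrite transE (fun_if (fun x => _ * x)) mulr0.
    rewrite -big_mkcond -big_distrl /=.
    rewrite (@sum_tableau _ _ _ (fun V => shift_compatible V (val W))
       (fun V => \prod_(k < n.+1) \prod_(i < T.-1) Cweight z V i k)).
    (* Values go outermost, since [row_sum] inserts value by value. *)
    under eq_bigr do rewrite exchange_big.
    rewrite (eq_bigl (fun V => is_tableau V &&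
               agree_off (@in_bottom n.+1) V (unshift (val W)))); last first.
      by move=> V; rewrite shift_compatible_unshift.
    rewrite row_sum; first last.
    + by move=> c /eqP c0; rewrite ffunE c0.
    + exact/unshift_tableau/valP.
    (* The last column has only its bottom cell, so without it the weight is 1 - y_0 = 1. *)
    rewrite exchange_big big_ord_recr /= [X in _ * X * _]big1 => [|i _].
      rewrite mulr1 mulrC /PiT big_ord_recl; congr (_ * _).
      apply: eq_bigr => k _; apply: eq_bigr => i _.
      by apply: Tweight_unshift => //; apply: valP.
    have no_top (c : cell n.+1) : ccol c = ord_max -> (0 < crow c)%N -> False.
      move=> cn; have := cell_lt c; rewrite cn /= ltnS.
      by rewrite -[X in (_ <= X)%N]addn0 leq_add2l leqNgt => /negP.
    rewrite Tweight_none => [|c /no_top//].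
    rewrite (_ : top_free _ _ _ = set0).
      by rewrite cards0 /ysum big_geq // subr0.
    by apply/setP => c; rewrite !inE; apply/and3P => -[/eqP /no_top].
  - by do 2!apply: prodr_ge0 => ? _; apply: ltW.
  - exact: total_mass.
split=> //; [by rewrite z_sum expr1n total_mass | by rewrite z_sum expr1n |].
move=> mu mu_stat; pose E (V : tableau n.+1 T) : tableau n.+1 T :=
  exist (fun V => is_tableau V) (shift (val V)) (shift_tableau (valP V)).
have tempty : is_tableau ([ffun=> None] : filling n.+1 T).
  by apply/tableauP => c d a b _; rewrite ffunE.
pose e : tableau n.+1 T := exist (fun V => is_tableau V) _ tempty.
apply: (@stationary_unique _ _ _ E e n.+1) stoch _ _ mu_stat stat => V.
  rewrite transE shift_compatible_shift /=.
  rewrite (_ : agree_off _ _ _); first by apply: prodr_gt0.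
  exact/agree_offP.
(* Each step by [E] moves the blank columns one to the right and adds another. *)
have emptyE m : cols_empty m (val (iter m E V)).
  elim: m => [|m IH]; apply/cols_emptyP => c //= cm.
  rewrite ffunE; case: ltnP => // c0; apply: (cols_emptyP _ _ IH).
  by case/andP: (diag_up_left c0) => /eqP kc _; rewrite kc in cm.
apply: val_inj; apply/ffunP => c; rewrite [RHS]ffunE.
exact: (cols_emptyP _ _ (emptyE n.+1) c (ltn_ord _)).
Qed.
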